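(* Let $\check\phi$ and $\chi$ be quantifier-free propositional formulas over atoms of the form $p > 0$ with $p$ a closed-form expression over $\mathbf{x}$, and let $\mathbf{a}$ be the loop update. Suppose $\chi(\mathbf{x}) \equiv \bigwedge_{i=1}^k C_i$ where each clause $C_i$ contains an inequation $\mathit{expr}_i(\mathbf{x}) > 0$ such that \[ \check\phi(\mathbf{x}) \land \mathit{expr}_i(\mathbf{x}) \geq \mathit{expr}_i(\mathbf{a}(\mathbf{x})) \implies \mathit{expr}_i(\mathbf{a}(\mathbf{x})) \geq \mathit{expr}_i(\mathbf{a}^2(\mathbf{x})). \] Then the conditional acceleration technique \[ (\langle \chi,\mathbf{a} \rangle, \check\phi) \mapsto \mathbf{x}' = \mathbf{a}^n(\mathbf{x}) \land \bigwedge_{i=1}^k \left( \mathit{expr}_i(\mathbf{x}) > 0 \land \mathit{expr}_i(\mathbf{a}^{n-1}(\mathbf{x})) > 0 \right) \] is sound. If moreover $C_i \equiv \mathit{expr}_i > 0$ for all $i \in [1,k]$, then this conditional acceleration technique is exact.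
   Context: A loop $\langle \phi, \mathbf{a}\rangle$, written ''while $\phi$ do $\mathbf{x} \leftarrow \mathbf{a}$'', operates on a vector $\mathbf{x}=(x_1,\ldots,x_d)$ of integer variables; $\phi$ is a propositional formula over atoms $p>0$ with $p$ a closed-form expression over $\mathbf{x}$, and $\mathbf{a}$ is a vector of closed-form expressions mapping integers to integers. It induces the relation $\mathbf{x} \longrightarrow_{\langle\phi,\mathbf{a}\rangle} \mathbf{x}'$ iff $\phi(\mathbf{x}) \land \mathbf{x}' = \mathbf{a}(\mathbf{x})$. $\mathbf{a}^n$ denotes $n$-fold application of $\mathbf{a}$, $n$ is a designated variable (number of iterations) and $\mathbf{x}'$ the values after $n$ iterations. A conditional acceleration technique is a partial function mapping a pair (loop $\langle\chi,\mathbf{a}\rangle$, formula $\check\phi$ over $\mathbf{x}$) to a formula over $\mathbf{x}, n, \mathbf{x}'$. It is sound if for all pairs in its domain, all $\mathbf{x},\mathbf{x}' \in \mathbb{Z}^d$ and $n>0$: $\mathbf{x} \longrightarrow^n_{\langle \check{\phi}, \mathbf{a} \rangle} \mathbf{x}'$ together with the produced formula implies $\mathbf{x} \longrightarrow^n_{\langle \chi, \mathbf{a} \rangle} \mathbf{x}'$. It is exact if additionally $\mathbf{x} \longrightarrow^n_{\langle \chi \land \check{\phi}, \mathbf{a} \rangle} \mathbf{x}'$ implies the produced formula. *)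

(* Defs.v *)
From HB Require Import structures.
From mathcomp Require Import all_boot all_order all_algebra.
From mathcomp Require Import reals.
From Stdlib Require List.

Set Implicit Arguments.
Unset Strict Implicit.
Unset Printing Implicit Defensive.

Import Order.TTheory GRing.Theory Num.Theory.
Local Open Scope ring_scope.

(* The class of closed forms is left open: closed forms are the terms built
   from variables, integer constants and an arbitrary family of function
   symbols (addition, multiplication, division, exponentiation, ...), each
   interpreted as a total real function. *)
Record symbols (R : realType) := Symbols {
  symbol : Type;
  arity : symbol -> nat;
  interp : forall f : symbol, ('I_(arity f) -> R) -> R
}.

Inductive expr (R : realType) (S : symbols R) (V : Type) : Type :=
| Var of V
| Cst of int
| App (f : symbol S) of ('I_(arity f) -> expr S V).

Fixpoint eval (R : realType) (S : symbols R) (V : Type)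
    (rho : V -> R) (p : expr S V) : R :=
  match p with
  | Var v => rho v
  | Cst z => z%:~R
  | App f ps => interp (fun i => eval rho (ps i))
  end.

(* [Atom p] is the inequation p > 0. *)
Inductive formula (R : realType) (S : symbols R) (V : Type) : Type :=
| Atom of expr S V
| FTrue
| FFalse
| FNot of formula S V
| FAnd of formula S V & formula S V
| FOr of formula S V & formula S V.

Arguments FTrue {R S V}.
Arguments FFalse {R S V}.

Fixpoint sat (R : realType) (S : symbols R) (V : Type)
    (rho : V -> R) (phi : formula S V) : Prop :=
  match phi with
  | Atom p => 0 < eval rho p
  | FTrue => True
  | FFalse => False
  | FNot phi1 => ~ sat rho phi1
  | FAnd phi1 phi2 => sat rho phi1 /\ sat rho phi2
  | FOr phi1 phi2 => sat rho phi1 \/ sat rho phi2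
  end.

Inductive literal (R : realType) (S : symbols R) (V : Type) : Type :=
| Pos of expr S V
| Neg of expr S V.

Definition literal_formula (R : realType) (S : symbols R) (V : Type)
    (l : literal S V) : formula S V :=
  match l with Pos p => Atom p | Neg p => FNot (Atom p) end.

(* A clause is the disjunction of the listed literals. *)
Definition clause (R : realType) (S : symbols R) (V : Type) :=
  seq (literal S V).

Definition clause_formula (R : realType) (S : symbols R) (V : Type)
    (c : clause S V) : formula S V :=
  foldr (fun l phi => FOr (literal_formula l) phi) FFalse c.

Definition conj_formula (R : realType) (S : symbols R) (V : Type)
    (k : nat) (phi : 'I_k -> formula S V) : formula S V :=
  foldr (fun i psi => FAnd (phi i) psi) FTrue (enum 'I_k).

(* The program variables x_1, ..., x_d are indexed by 'I_d. *)
Definition state (d : nat) := 'rV[int]_d.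

Definition state_val (R : realType) (d : nat) (x : state d) : 'I_d -> R :=
  fun j => (x 0 j)%:~R.

Definition eval_at (R : realType) (S : symbols R) (d : nat)
    (p : expr S 'I_d) (x : state d) : R := eval (state_val R x) p.

Definition holds (R : realType) (S : symbols R) (d : nat)
    (phi : formula S 'I_d) (x : state d) : Prop := sat (state_val R x) phi.

Definition formula_equiv (R : realType) (S : symbols R) (d : nat)
    (phi psi : formula S 'I_d) : Prop :=
  forall x : state d, holds phi x <-> holds psi x.

Record update (R : realType) (S : symbols R) (d : nat) := Update {
  update_expr : 'I_d -> expr S 'I_d;
  update_int : forall (x : state d) (j : 'I_d),
    eval_at (update_expr j) x \is a Num.int
}.

(* By update_int, the floor is here the exact conversion from R to int. *)
Definition apply_update (R : realType) (S : symbols R) (d : nat)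
    (a : update S d) (x : state d) : state d :=
  \row_j Num.floor (eval_at (update_expr a j) x).

Record loop (R : realType) (S : symbols R) (d : nat) := Loop {
  guard : formula S 'I_d;
  body : update S d
}.

Definition step (R : realType) (S : symbols R) (d : nat)
    (l : loop S d) (x x' : state d) : Prop :=
  holds (guard l) x /\ x' = apply_update (body l) x.

Fixpoint steps (R : realType) (S : symbols R) (d : nat)
    (l : loop S d) (n : nat) (x x' : state d) : Prop :=
  match n with
  | 0%N => x = x'
  | m.+1 => exists2 z, step l x z & steps l m z x'
  end.

(* The variables x, n, x' of accelerated formulas. *)
Inductive accel_var (d : nat) : Type :=
| Before of 'I_d
| Iterations
| After of 'I_d.

Definition accel_val (R : realType) (d : nat)
    (x : state d) (n : nat) (x' : state d) (v : accel_var d) : R :=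
  match v with
  | Before j => (x 0 j)%:~R
  | Iterations => n%:R
  | After j => (x' 0 j)%:~R
  end.

Definition accel_holds (R : realType) (S : symbols R) (d : nat)
    (F : formula S (accel_var d)) (x : state d) (n : nat) (x' : state d) :
  Prop := sat (accel_val R x n x') F.

(* Partial functions: [None] means that the pair is not in the domain. *)
Definition technique (R : realType) (S : symbols R) (d : nat) :=
  loop S d -> formula S 'I_d -> option (formula S (accel_var d)).

Definition sound (R : realType) (S : symbols R) (d : nat)
    (T : technique S d) : Prop :=
  forall (chi : formula S 'I_d) (a : update S d) (phi : formula S 'I_d)
         (F : formula S (accel_var d)),
    T (Loop chi a) phi = Some F ->
    forall (x x' : state d) (n : nat), (0 < n)%N ->
      steps (Loop phi a) n x x' -> accel_holds F x n x' ->
      steps (Loop chi a) n x x'.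

Definition exact (R : realType) (S : symbols R) (d : nat)
    (T : technique S d) : Prop :=
  sound T /\
  forall (chi : formula S 'I_d) (a : update S d) (phi : formula S 'I_d)
         (F : formula S (accel_var d)),
    T (Loop chi a) phi = Some F ->
    forall (x x' : state d) (n : nat), (0 < n)%N ->
      steps (Loop (FAnd chi phi) a) n x x' -> accel_holds F x n x'.

(* The clauses C_i and the selected expressions expr_i, for i < k. *)
Record selection (R : realType) (S : symbols R) (d : nat) := Selection {
  nclauses : nat;
  clauses : 'I_nclauses -> clause S 'I_d;
  exprs : 'I_nclauses -> expr S 'I_d
}.

Arguments clauses {R S d} s i.
Arguments exprs {R S d} s i.

Definition eventual_decrease (R : realType) (S : symbols R) (d : nat)
    (chi : formula S 'I_d) (a : update S d) (phi : formula S 'I_d)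
    (s : selection S d) : Prop :=
  formula_equiv chi (conj_formula (fun i => clause_formula (clauses s i))) /\
  forall i : 'I_(nclauses s),
    List.In (Pos (exprs s i)) (clauses s i) /\
    forall x : state d,
      holds phi x /\
      eval_at (exprs s i) x >= eval_at (exprs s i) (apply_update a x) ->
      eval_at (exprs s i) (apply_update a x) >=
      eval_at (exprs s i) (apply_update a (apply_update a x)).

(* F expresses
   x' = a^n(x) /\ forall i, expr_i(x) > 0 /\ expr_i(a^(n-1)(x)) > 0.
   This is a condition on the meaning of F, since its syntax depends on the
   closed form that is used for a^n. *)
Definition eventual_decrease_formula (R : realType) (S : symbols R) (d : nat)
    (a : update S d) (s : selection S d) (F : formula S (accel_var d)) :
  Prop :=
  forall (x x' : state d) (n : nat), (0 < n)%N ->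
    accel_holds F x n x' <->
    x' = iter n (apply_update a) x /\
    forall i : 'I_(nclauses s),
      0 < eval_at (exprs s i) x /\
      0 < eval_at (exprs s i) (iter n.-1 (apply_update a) x).

(* Main.v *)
(* Along a run whose states satisfy phi, the values of expr_i form a sequence
   that, once it stops increasing, never increases again.  Such a unimodal
   sequence attains its minimum over an initial segment at an endpoint, so it is
   positive throughout as soon as its first and last values are. *)
Require Import Defs.
From mathcomp Require Import all_boot all_order all_algebra.
From mathcomp Require Import reals.

Set Implicit Arguments.
Unset Strict Implicit.
Unset Printing Implicit Defensive.

Import Order.TTheory.

(** Induction on [n], shifting [u] by one: the tail inherits the hypotheses as soon as [c < u 1]. *)
Lemma unimodal_gt (disp : Order.disp_t) (T : orderType disp) (u : nat -> T)
    (c : T) (n : nat) :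
  (forall m, (m < n)%N -> (u m.+1 <= u m)%O -> (u m.+2 <= u m.+1)%O) ->
  (c < u 0)%O -> (c < u n)%O -> forall m, (m <= n)%N -> (c < u m)%O.
Proof.
elim: n u => [|n IHn] u u_dec u0 un [|m] // le_mn.
apply: (IHn (u \o S)) le_mn => //= [k lt_kn|]; first exact: u_dec.
(* If [u] rises at once, then [c < u 0 < u 1]; otherwise it descends all the way, so [u 1] is at
   least [u n.+1]. *)
case: (leP (u 1) (u 0)) => [u10|]; last exact: lt_trans.
have dec k : (k <= n.+1)%N -> (u k.+1 <= u k)%O.
  by elim: k => // k IHk lt_kn; apply: u_dec => //; apply/IHk/ltnW.
apply: lt_le_trans un _.
(* Frees the index for induction but keeps the bound [n], as [dec] covers only an initial
   segment. *)
have: (n <= n)%N by [].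
elim: {-2}n => // k IHk lt_kn.
by apply: le_trans (IHk (ltnW lt_kn)); apply: dec; exact: ltnW.
Qed.

Section Formulas.
Variables (R : realType) (S : symbols R).

Lemma sat_conj_formula (V : Type) (rho : V -> R) (k : nat)
    (phi : 'I_k -> formula S V) :
  sat rho (conj_formula phi) <-> forall i, sat rho (phi i).
Proof.
(* Induction needs an arbitrary list in place of [enum 'I_k]. *)
suff H (s : seq 'I_k) : sat rho (foldr (fun i psi => FAnd (phi i) psi) FTrue s)
    <-> forall i, i \in s -> sat rho (phi i).
  split=> [/H sat_phi i|sat_phi]; first by apply: sat_phi; rewrite mem_enum.
  by apply/H => i _; apply: sat_phi.
elim: s => [|j s IHs] //=; split=> [[sat_j /IHs sat_s] i|sat_s].
  by rewrite inE => /predU1P[->|/sat_s].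
split; first by apply: sat_s; rewrite mem_head.
by apply/IHs => i i_s; apply: sat_s; rewrite inE i_s orbT.
Qed.

Lemma sat_clause_formula (V : Type) (rho : V -> R) (l : literal S V)
    (C : clause S V) :
  List.In l C -> sat rho (literal_formula l) -> sat rho (clause_formula C).
Proof.
by elim: C => //= l' C IHC [-> | /IHC sat_C] sat_l; [left | right; apply: sat_C].
Qed.

(** The update is deterministic, so the guard only filters the orbit of [x]; it is never tested on
    the final state. *)
Lemma stepsP (d : nat) (phi : formula S 'I_d) (a : update S d) (n : nat)
    (x x' : state d) :
  steps (Loop phi a) n x x' <->
  x' = iter n (apply_update a) x /\
  forall m, (m < n)%N -> holds phi (iter m (apply_update a) x).
Proof.
elim: n x x' => [|n IHn] x x' /=; first by split=> [-> | []].
split=> [[z [phi_x ->] /IHn[-> phi_iter]]|[-> phi_iter]].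
  rewrite -iterSr; split=> // -[|m] // lt_mn.
  by rewrite iterSr; apply: phi_iter.
exists (apply_update a x); first by split=> //; apply: (phi_iter 0).
apply/IHn; rewrite -iterSr; split=> // m lt_mn.
by rewrite -iterSr; apply: phi_iter.
Qed.

End Formulas.

Theorem theorem11 (R : realType) (S : symbols R) (d : nat)
    (T : technique S d)
    (sel : loop S d -> formula S 'I_d -> selection S d)
    (hT : forall (chi : formula S 'I_d) (a : update S d)
                 (phi : formula S 'I_d) (F : formula S (accel_var d)),
        T (Loop chi a) phi = Some F ->
        eventual_decrease chi a phi (sel (Loop chi a) phi) /\
        eventual_decrease_formula a (sel (Loop chi a) phi) F) :
  sound T /\
  ((forall (chi : formula S 'I_d) (a : update S d)
           (phi : formula S 'I_d) (F : formula S (accel_var d)),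
       T (Loop chi a) phi = Some F ->
       forall i : 'I_(nclauses (sel (Loop chi a) phi)),
         formula_equiv (clause_formula (clauses (sel (Loop chi a) phi) i))
                       (Atom (exprs (sel (Loop chi a) phi) i))) ->
   exact T).
Proof.
have soundT : sound T.
  move=> chi a phi F TF x x' n n_gt0 /stepsP[_ phi_iter].
  have [[chiE sel_dec] FE] := hT _ _ _ _ TF.
  move=> /(FE _ _ _ n_gt0)[x'E expr_gt0]; apply/stepsP; split=> // m lt_mn.
  apply/chiE/sat_conj_formula => i.
  have [in_C dec] := sel_dec i; have [gt0 gtn] := expr_gt0 i.
  (* The selected literal alone makes the clause true. *)
  apply: sat_clause_formula in_C _ => /=.
  pose u m := eval_at (exprs (sel (Loop chi a) phi) i)
    (iter m (apply_update a) x).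
  (* The last state where [chi] must hold is the one after [n.-1] updates, hence this endpoint. *)
  apply: (@unimodal_gt _ _ u _ n.-1) => // [k lt_kn le_u|].
    apply: dec; split=> //; apply: phi_iter.
    exact: leq_trans lt_kn (leq_pred n).
  by rewrite -ltnS prednK.
split=> // atomC; split=> // chi a phi F TF x x' n n_gt0 /stepsP[x'E chi_iter].
have [[chiE _] FE] := hT _ _ _ _ TF.
apply/(FE _ _ _ n_gt0); split=> // i.
(* Clauses now coincide with their atoms, so the guard gives positivity along the run, in particular
   at [0] and [n.-1]. *)
have expr_gt0 m : (m < n)%N ->
    sat (state_val R (iter m (apply_update a) x))
      (Atom (exprs (sel (Loop chi a) phi) i)).
  move=> /chi_iter[/chiE/sat_conj_formula/(_ i) sat_C _].
  exact/(atomC _ _ _ _ TF).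
by split; [exact: (expr_gt0 0) | apply: expr_gt0; rewrite prednK].
Qed.
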